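(* Let $T:[0,1)\to[0,1)$ be the Gauss map, let $D$ be the set of all $x\in[0,1)$ whose orbit $\{T^n(x):n\ge 0\}$ is dense in $[0,1]$, and let $D^c=[0,1]\setminus D$. Then: (1) $D$ is of full Lebesgue measure in $[0,1]$; (2) $D^c$ is of full Hausdorff dimension, i.e. $\dim_H D^c=1$; (3) $D^c$ is of the first category (meager) in $[0,1]$; (4) both $D^c$ and $D$ are dense in $[0,1]$.
   Context: The Gauss map $T:[0,1)\to[0,1)$ is defined by $T(0)=0$ and $T(x)=\frac1x-\lfloor \frac1x\rfloor$ for $x\in(0,1)$, where $\lfloor y\rfloor$ is the integer part of $y$. $\dim_H$ denotes Hausdorff dimension. *)

(* Defs.v *)
From mathcomp Require Import all_boot all_order all_algebra.
From mathcomp Require Import all_classical all_reals all_analysis.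
Set Implicit Arguments.
Unset Strict Implicit.
Unset Printing Implicit Defensive.
Import Order.TTheory GRing.Theory Num.Theory.
Import numFieldNormedType.Exports.
Local Open Scope classical_set_scope.
Local Open Scope ring_scope.

(* Totalized to R; only its values on [0, 1[ matter (see gauss_map_itv). *)
Definition gauss_map (R : realType) (x : R) : R :=
  if x == 0 then 0 else x^-1 - (Num.floor x^-1)%:~R.

Lemma gauss_map_itv (R : realType) (x : R) :
  `[0, 1[%classic x -> `[0, 1[%classic (gauss_map x).
Proof.
move=> _; rewrite /gauss_map /= in_itv /=; case: ifP => _.
  by rewrite lexx ltr01.
by rewrite subr_ge0 floor_le ltrBlDl -[1]/(1%:~R) -intrD floorD1_gt.
Qed.

Definition gauss_orbit (R : realType) (x : R) : set R :=
  range (fun n : nat => iter n (@gauss_map R) x).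

Definition dense_in (T : topologicalType) (X A : set T) : Prop :=
  A `<=` X /\ X `<=` closure A.

Definition unit_itv (R : realType) : set R := `[0, 1]%classic.
Arguments unit_itv R : clear implicits.

Definition gauss_dense (R : realType) : set R :=
  [set x : R | `[0, 1[%classic x /\ dense_in (unit_itv R) (gauss_orbit x)].
Arguments gauss_dense R : clear implicits.

Definition gauss_dense_compl (R : realType) : set R :=
  unit_itv R `\` gauss_dense R.
Arguments gauss_dense_compl R : clear implicits.

Definition nowhere_dense (T : topologicalType) (A : set T) : Prop :=
  interior (closure A) = set0.

Definition meager (T : topologicalType) (A : set T) : Prop :=
  exists F : nat -> set T,
    (forall n, nowhere_dense (F n)) /\ A = \bigcup_n F n.

(* In [subspace X] the points outside X are isolated, so a set which is
   nowhere dense in [subspace X] is contained in X, and its closure and the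
   interior of that closure are those computed in X with the induced topology. *)
Definition meager_in (T : topologicalType) (X A : set T) : Prop :=
  @meager (subspace X) A.

Section hausdorff_dimension.
Context {R : realType}.
Local Open Scope ereal_scope.

(* The maximum with 0 only serves to get diameter set0 = 0. *)
Definition diameter (U : set R) : \bar R :=
  maxe 0 (ereal_sup [set (`|p.1 - p.2|%R)%:E | p in U `*` U]).

(* diam(U)^s, with the conventions diam(set0)^0 = 0 and 0^0 = 1 otherwise. *)
Definition hausdorff_weight (s : R) (U : set R) : \bar R :=
  if U == set0 then 0 else diameter U `^ s.

Definition hausdorff_delta (s delta : R) (A : set R) : \bar R :=
  ereal_inf [set \sum_(0 <= n <oo) hausdorff_weight s (U n) |
    U in [set U : nat -> set R |
      A `<=` \bigcup_n U n /\ forall n, diameter (U n) <= delta%:E]].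

(* The limit as delta -> 0+, which is a supremum by monotonicity in delta. *)
Definition hausdorff_measure (s : R) (A : set R) : \bar R :=
  ereal_sup [set hausdorff_delta s delta A | delta in [set d : R | (0 < d)%R]].

Definition hausdorff_dim (A : set R) : \bar R :=
  ereal_inf [set s%:E | s in [set s : R |
    (0 <= s)%R /\ hausdorff_measure s A = 0]].

End hausdorff_dimension.

(* Main.v *)
(* The branches of [T^n] are the maps [t |-> 1/(a1 + 1/(... + 1/(an + t)))].
   With q_n the denominators of the convergents, such a branch scales all
   distances by 1/(q_n(q_n + q_{n-1})) up to a factor 2, on all of [0, 1].

   A non-dense orbit is finite or avoids an interval ]a, b[ with rational ends.
   Pulling ]a, b[ back along the branches shows that the set of points whose
   orbits avoid ]a, b[ is porous, with a fixed constant, at every irrational.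
   So is its closure, which is therefore null by Lebesgue's density theorem, and
   a closed null set has empty interior. This gives (1), (3) and the density of
   D; rational points have finite orbits, whence the density of the complement.

   For (2), points whose digits are all at most N have orbits bounded away
   from 0. The child of a cylinder with digit a has relative length
   (1 + y)/((a + y)(a + 1 + y)) with y = q_{n-1}/q_n; over all a >= 1 these
   lengths add up to 1 and each is at most 1/2, so for s < 1 and N large their
   s-th powers over a <= N add up to at least 1. The tails of digits at most N
   leave gaps between siblings comparable to the length of the parent. If a
   cover of this Cantor set had too small a sum of diameters^s, no covering set
   could meet two siblings, hence some child would again be covered too
   cheaply; following such children forever contradicts the positivity of the
   weight of the set that covers the limit point. *)

Require Import Defs.
From mathcomp Require Import all_boot all_order all_algebra.
From mathcomp Require Import all_classical all_reals all_analysis.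
From mathcomp Require Import measurable_realfun ring lra.
Set Implicit Arguments.
Unset Strict Implicit.
Unset Printing Implicit Defensive.
Import Order.TTheory GRing.Theory Num.Theory.
Import numFieldNormedType.Exports.
Local Open Scope classical_set_scope.
Local Open Scope ring_scope.

(** * Inverse branches of the iterated Gauss map and their distortion *)

Section continued_fractions.
Variable R : realType.
Implicit Types (v : seq nat) (a : nat) (t u x : R).

(* Digits are listed innermost first: [cf [:: an; ...; a1] t] is
   1/(a1 + 1/(... + 1/(an + t))), so consing a digit refines the cylinder. *)
Fixpoint cf v t : R := if v is a :: v' then cf v' (a%:R + t)^-1 else t.

(* The last two denominators q_n and q_{n-1} of the convergents. *)
Fixpoint cfden v : R * R :=
  if v is a :: v' then (a%:R * (cfden v').1 + (cfden v').2, (cfden v').1)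
  else (1, 0).

(** The length of the image of [0, 1] under [cf v]: the case t = 0, u = 1 of [dist_cf]. *)
Definition cflen v : R := ((cfden v).1 * ((cfden v).1 + (cfden v).2))^-1.

Definition digits v := all (leq 1) v.

Lemma cfden_bounds v : digits v ->
  [/\ 0 < (cfden v).1, 0 <= (cfden v).2 & (cfden v).2 <= (cfden v).1].
Proof.
elim: v => [_|a v IH /= /andP[a1 /IH [q0 q'0 q'q]]] /=; first by split.
have a1R : (1 : R) <= a%:R by rewrite ler1n.
split; nra.
Qed.

(** The branch is a Moebius map of determinant 1 or -1 with denominator q + q' t. The induction
    rests on (a + t)(q + q'/(a + t)) = (a q + q') + q t. *)
Lemma dist_cf v t u : digits v -> 0 <= t -> 0 <= u ->
  `|cf v t - cf v u| = `|t - u| /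
    (((cfden v).1 + (cfden v).2 * t) * ((cfden v).1 + (cfden v).2 * u)).
Proof.
elim: v t u => [|a v IH] t u /=.
  by move=> _ _ _; rewrite !mul0r !addr0 mul1r divr1.
move=> /andP[a1 pv] t0 u0; have [q0 q'0 _] := cfden_bounds pv.
have a1R : (1 : R) <= a%:R by rewrite ler1n.
have at0 : 0 < a%:R + t by lra.
have au0 : 0 < a%:R + u by lra.
rewrite IH ?invr_ge0 ?ltW//.
have -> : (a%:R + t)^-1 - (a%:R + u)^-1 =
    (u - t) / ((a%:R + t) * (a%:R + u)) by field; lra.
rewrite normrM normfV (gtr0_norm (mulr_gt0 at0 au0)) distrC.
field.
by rewrite !gt_eqF//=; nra.
Qed.

(** The denominator in [dist_cf] lies between q^2 and (q + q')^2, and since q' <= q both are within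
    a factor 2 of q(q + q'). *)
Lemma cf_lip v t u : digits v -> 0 <= t <= 1 -> 0 <= u <= 1 ->
  cflen v / 2 * `|t - u| <= `|cf v t - cf v u| <= 2 * cflen v * `|t - u|.
Proof.
move=> pv /andP[t0 t1] /andP[u0 u1]; rewrite dist_cf// /cflen.
have [q0 q'0 qq'] := cfden_bounds pv.
move: (cfden v).1 (cfden v).2 q0 q'0 qq' => q q' q0 q'0 qq'.
have Q0 : 0 < q * (q + q') by nra.
have D0 : 0 < (q + q' * t) * (q + q' * u) by apply: mulr_gt0; nra.
rewrite [X in X <= _ <= _]mulrC [X in _ <= _ <= X]mulrC.
have qq0 : q * q' <= q * q by rewrite ler_pM2l.
have qq1 : q' * q' <= q * q' by rewrite ler_wpM2r.
have le1 : q * q <= (q + q' * t) * (q + q' * u) by apply: ler_pM; nra.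
have le2 : (q + q' * t) * (q + q' * u) <= (q + q') * (q + q').
  by apply: ler_pM; nra.
apply/andP; split; rewrite ler_wpM2l//.
  by rewrite -invfM lef_pV2 ?posrE//; lra.
by rewrite ler_pdivlMr// mulrC ler_pdivrMr//; lra.
Qed.

Lemma cflen_gt0 v : digits v -> 0 < cflen v.
Proof. by move=> /cfden_bounds[q0 q'0 _]; rewrite invr_gt0; nra. Qed.

Lemma cflen_cons v a : digits v -> (0 < a)%N ->
  let y := (cfden v).2 / (cfden v).1 in
  cflen (a :: v) = cflen v * ((1 + y) / ((a%:R + y) * (a%:R + 1 + y))).
Proof.
move=> pv a0 y; have [q0 q'0 qq'] := cfden_bounds pv.
have a1R : (1 : R) <= a%:R by rewrite ler1n.
rewrite /y /cflen /=; field.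
by rewrite !gt_eqF//=; nra.
Qed.

Lemma digit_ratio_le a (y : R) : (0 < a)%N -> 0 <= y ->
  (1 + y) / ((a%:R + y) * (a%:R + 1 + y)) <= 2^-1.
Proof.
move=> a0 y0; have a1R : (1 : R) <= a%:R by rewrite ler1n.
rewrite ler_pdivrMr; last by nra.
suff : (1 + y) * 2 <= (a%:R + y) * (a%:R + 1 + y) by lra.
by apply: ler_pM; lra.
Qed.

Lemma cflen_exp v : digits v -> cflen v <= 2^-1 ^+ size v.
Proof.
elim: v => [_|a v IH /= /andP[a1 pv]].
  by rewrite /cflen /= addr0 mulr1 invr1.
rewrite cflen_cons// exprSr; have [q0 q'0 qq'] := cfden_bounds pv.
have a1R : (1 : R) <= a%:R by rewrite ler1n.
have y0 : 0 <= (cfden v).2 / (cfden v).1 by rewrite divr_ge0// ltW.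
apply: ler_pM; [exact/ltW/cflen_gt0| |exact: IH|exact: digit_ratio_le].
by rewrite divr_ge0 ?mulr_ge0//; lra.
Qed.

Lemma gauss_map_inv a t : (0 < a)%N -> 0 <= t < 1 ->
  gauss_map (a%:R + t)^-1 = t.
Proof.
move=> a0 /andP[t0 t1]; have a1R : (1 : R) <= a%:R by rewrite ler1n.
rewrite /gauss_map invr_eq0 gt_eqF; last by lra.
rewrite invrK (@floor_def _ _ (a%:Z)).
  by rewrite -pmulrn addrC addKr.
by rewrite intrD -!pmulrn; apply/andP; split; lra.
Qed.

(** Each step strips one digit. The value t = 0 is excluded because the digit 1 would send it to 1,
    outside [0, 1[. *)
Lemma iter_gauss_cf v t : digits v -> 0 < t < 1 ->
  iter (size v) (@gauss_map R) (cf v t) = t.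
Proof.
elim: v t => [//|a v IH] t /= /andP[a1 pv] /andP[t0 t1].
have a1R : (1 : R) <= a%:R by rewrite ler1n.
rewrite IH// ?gauss_map_inv ?t1 ?(ltW t0)//.
by rewrite invr_gt0 invf_lt1 ?posrE; [apply/andP; split; lra|lra].
Qed.

Lemma gauss_mapE x : 0 < x < 1 ->
  exists2 a, (0 < a)%N & x = (a%:R + gauss_map x)^-1.
Proof.
move=> /andP[x0 x1]; have xV1 : 1 <= x^-1 by rewrite invf_ge1// ltW.
have f1 : 1%:Z <= Num.floor x^-1 by rewrite floor_ge_int.
exists (`|Num.floor x^-1|)%N; first by rewrite absz_gt0 gt_eqF// (lt_le_trans _ f1).
rewrite /gauss_map gt_eqF// natr_absz ger0_norm; last exact: le_trans f1.
by rewrite addrC subrK invrK.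
Qed.

Lemma iter_gauss_itv x n : 0 <= x < 1 -> 0 <= iter n (@gauss_map R) x < 1.
Proof.
move=> x01; elim: n => [//|n IH] /=.
by have := @gauss_map_itv R (iter n (@gauss_map R) x); rewrite /= !in_itv /=; apply.
Qed.

Lemma cf_expansion x n : 0 <= x < 1 ->
  (forall k, iter k (@gauss_map R) x != 0) ->
  exists v, [/\ digits v, size v = n & x = cf v (iter n (@gauss_map R) x)].
Proof.
move=> x01 xn0; elim: n => [|n [v [pv sv xE]]]; first by exists [::].
have /andP[T0 T1] := iter_gauss_itv n x01.
have [|a a0 TE] := @gauss_mapE (iter n (@gauss_map R) x).
  by rewrite lt_neqAle eq_sym xn0 T0.
by exists (a :: v); split; rewrite /= ?a0 ?sv// -TE.
Qed.

Lemma continuous_cf v t : digits v -> 0 < t -> {for t, continuous (cf v)}.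
Proof.
elim: v t => [|a v IH] t /=; first by move=> _ _; exact: cvg_id.
move=> /andP[a1 pv] t0; have at0 : 0 < a%:R + t by rewrite ltr_wpDl.
apply: (@continuous_comp _ _ _ (fun t => (a%:R + t)^-1) (cf v)).
  by apply: cvgV; [rewrite gt_eqF|apply: cvgD; [exact: cvg_cst|exact: cvg_id]].
by apply: IH => //; rewrite invr_gt0.
Qed.

Lemma within_continuous_cf v t u : digits v -> 0 < t ->
  {within `[t, u], continuous (cf v)}.
Proof.
move=> pv t0; apply: continuous_in_subspaceT => x.
rewrite inE /= in_itv /= => /andP[tx _].
by apply: continuous_cf => //; exact: lt_le_trans tx.
Qed.

End continued_fractions.

(** * Porosity and Lebesgue density *)

Section porosity.
Variable R : realType.
Implicit Types (A : set R) (a b c x : R).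

Definition porous_at A c x := forall e, 0 < e -> exists r lo hi : R,
  [/\ 0 < r < e, c * r <= hi - lo, `]lo, hi[ `<=` ball x r &
      `]lo, hi[ `&` A = set0].

(** A hole of length at least c r leaves A at most the fraction 1 - c/2 of a ball of length 2 r, at
    arbitrarily small scales. *)
Lemma porous_density A c x : measurable A -> 0 < c -> porous_at A c x ->
  ~ ((lebesgue_measure (A `&` ball x r) / lebesgue_measure (ball x r))%E
       @[r --> 0^'+] --> 1%:E).
Proof.
move=> mA c0 pAx /(_ [set y | (1 - c / 2)%:E < y]%E).
case.
  apply: open_nbhs_nbhs; split; first exact: open_ereal_gt_ereal.
  by rewrite /= lte_fin; lra.
move=> e /= e0 He; have [r [lo [hi [/andP[r0 re] cr Kx KA]]]] := pAx e e0.
have := He r; rewrite /= distrC subr0 gtr0_norm// => /(_ re r0).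
rewrite lebesgue_measure_ball ?ltW//.
have mK : measurable (`]lo, hi[%classic : set R) by exact: measurable_itv.
have mB : measurable (ball x r : set R) by exact: measurable_ball.
have lohi : lo < hi by rewrite -subr_gt0; apply: lt_le_trans cr; rewrite mulr_gt0.
have KE : lebesgue_measure (`]lo, hi[%classic : set R) = (hi - lo)%:E.
  by rewrite lebesgue_measure_itv /= lte_fin lohi EFinB.
have : (lebesgue_measure (A `&` ball x r) + (hi - lo)%:E <= (r *+ 2)%:E)%E.
  rewrite -KE -(lebesgue_measure_ball x (ltW r0)) -measureU//.
  - apply: le_measure; rewrite ?inE//.
    + by apply: measurableU => //; exact: measurableI.
    + by move=> y [[]//|/Kx].
  - exact: measurableI.
  - by apply/seteqP; split => // y [[Ay _] Ky]; rewrite -KA.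
have : (0 <= lebesgue_measure (A `&` ball x r))%E by exact: measure_ge0.
case: (lebesgue_measure _) => [m| |]//=.
rewrite !lee_fin => m0 mr; rewrite inver mulrn_eq0 (gt_eqF r0) -EFinM lte_fin.
rewrite ltr_pdivlMr; last by rewrite pmulrn_lgt0.
by move: mr; rewrite !(mulr2n r) => mr H; lra.
Qed.

(** By the density theorem almost every point of A has density 1, which porosity forbids; the
    rational points are countable, hence null. *)
Lemma closed_porous_null A c : closed A -> 0 < c ->
  (forall x, A x -> ~ range (@ratr R) x -> porous_at A c x) ->
  lebesgue_measure A = 0.
Proof.
move=> cA c0 pA; have mA := closed_measurable cA.
have [N [mN N0 NP]] := lebesgue_density mA.
apply/eqP; rewrite -measure_le0.
have mQ : measurable (range ratr : set R).
  apply: countable_measurable => //.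
  exact: card_le_trans (card_image_le _ _) (countableP _).
apply: (@le_trans _ _ (lebesgue_measure (N `|` range (@ratr R)))).
  apply: le_measure; rewrite ?inE//; first exact: measurableU.
  move=> x Ax; have [|xQ] := pselect (range (@ratr R) x); first by right.
  left; apply: NP => /= H; apply: (porous_density mA c0 (pA x Ax xQ)).
  by move: H; rewrite indicE mem_set.
apply: (le_trans (measureU2 _ mN mQ)).
by rewrite [X in (X + _)%E]N0 [X in (_ + X)%E]lebesgue_measure_rat adde0.
Qed.

End porosity.

(** * Orbits avoiding an interval *)

Section gauss_porous.
Variable R : realType.
Implicit Types (a b x : R) (n : nat).

(** Undoing a step of the map preserves rationality. Hence the orbit of an irrational never meets 0,
    and [cf_expansion] applies at every depth. *)
Lemma gauss_rat x n : 0 <= x < 1 -> iter n (@gauss_map R) x = 0 ->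
  range (@ratr R) x.
Proof.
elim: n x => [|n IH] x x01; first by move=> /= ->; exists 0 => //; rewrite rmorph0.
rewrite iterSr => /IH; have := iter_gauss_itv 1 x01; rewrite /= => Tx /(_ Tx).
have [->|x0] := eqVneq x 0; first by exists 0 => //; rewrite rmorph0.
case/andP: x01 => x0' x1; have [|d d0 xE [q _ qE]] := @gauss_mapE _ x.
  by rewrite lt_neqAle eq_sym x0 x0'.
by exists ((d%:R + q)^-1) => //; rewrite fmorphV rmorphD /= rmorph_nat qE -xE.
Qed.

Definition gauss_avoid a b : set R :=
  [set x | 0 <= x < 1 /\ forall n, ~~ (a < iter n (@gauss_map R) x < b)].

Lemma porous_gauss_avoid a b x : 0 < a -> a < b -> b <= 1 ->
  0 <= x < 1 -> ~ range (@ratr R) x ->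
  porous_at (closure (gauss_avoid a b)) ((b - a) / 8) x.
Proof.
move=> a0 ab b1 x01 xQ e e0.
have [n ne] : exists n, 4 * (2^-1 ^+ n : R) < e.
  have /cvgr0_norm_lt/(_ _ (divr_gt0 e0 (ltr0n _ 4))) :=
    @cvg_expr R 2^-1 ltac:(by rewrite ger0_norm; lra).
  move=> [n _ /(_ n (leqnn n))] /=; rewrite ger0_norm ?exprn_ge0//; exists n; lra.
have [|v [pv sv xE]] := cf_expansion n x01.
  by move=> k; apply/eqP => /(gauss_rat x01).
have c0 := cflen_gt0 R pv; have cn := cflen_exp R pv.
set t := iter n _ x in xE.
have /andP[t0 t1] : 0 <= t < 1 by exact: iter_gauss_itv.
(* The hole is the image of ]a, b[ under the branch through x, with [min] and [max] because the
   branch may be decreasing. Its length is at least [cflen v] (b - a)/2, and it lies within 2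
   [cflen v] of x. *)
exists (4 * cflen R v), (Num.min (cf v a) (cf v b)), (Num.max (cf v a) (cf v b)).
(* By the intermediate value theorem, every point strictly between the two end values is the image
   of some u in ]a, b[. *)
have Kcf z : Num.min (cf v a) (cf v b) < z < Num.max (cf v a) (cf v b) ->
    exists2 u, a < u < b & z = cf v u.
  move=> /andP[z1 z2].
  have [||u] := @IVT R (cf v) a b z (ltW ab).
  - exact: within_continuous_cf.
  - by rewrite !ltW.
  rewrite in_itv /= => /andP[au ub] uz; exists u => //.
  move: z1 z2; rewrite -uz gt_min lt_max => z1 z2.
  rewrite !lt_neqAle au ub !andbT.
  by apply/andP; split; apply/eqP => ue; move: z1 z2; rewrite ?ue -?ue !ltxx
    ?orbF /= => ? ?; lra.
split.
- apply/andP; split; first lra.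
  by rewrite sv in cn; lra.
- have -> : Num.max (cf v a) (cf v b) - Num.min (cf v a) (cf v b) = `|cf v a - cf v b|.
    by case: (leP (cf v a) (cf v b)) => h; [rewrite distrC|]; rewrite ger0_norm ?subr_ge0// ltW.
  have /andP[+ _] := @cf_lip R v a b pv ltac:(by lra) ltac:(by lra).
  by rewrite distrC (ger0_norm (_ : 0 <= b - a)); [lra|lra].
- move=> z; rewrite /= in_itv /= => /Kcf[u /andP[au ub] ->].
  rewrite /ball /= xE.
  have /andP[_] := @cf_lip R v t u pv ltac:(by lra) ltac:(by lra).
  move=> /le_lt_trans; apply.
  have : `|t - u| <= 1 by rewrite ler_norml; lra.
  nra.
(* The hole is open, so missing the set makes it miss the closure as well. *)
- have Kopen : open (`]Num.min (cf v a) (cf v b), Num.max (cf v a) (cf v b)[%classic : set R).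
    exact: interval_open.
  apply/seteqP; split => // z [Kz] /(_ _ (open_nbhs_nbhs (conj Kopen Kz))).
  move=> [y [[_ /(_ n)]]] + Ky; move: Ky; rewrite /= in_itv /= =>
    /Kcf[u /andP[au ub] ->].
  by rewrite -sv iter_gauss_cf// ?au ?ub//; lra.
Qed.

Lemma gauss_avoid_null a b : 0 < a -> a < b -> b <= 1 ->
  lebesgue_measure (closure (gauss_avoid a b)) = 0.
Proof.
move=> a0 ab b1; apply: (@closed_porous_null R _ ((b - a) / 8)).
- exact: closed_closure.
- by lra.
move=> x Ax xQ; apply: porous_gauss_avoid => //.
(* The closure stays in [0, 1], and its only possible point outside [0, 1[ is the rational 1. *)
have : `[0, 1]%classic x.
  suff /closure_id -> : closed (`[0, 1]%classic : set R).
    apply: closure_subset Ax => y [/andP[y0 y1] _].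
    by rewrite /= in_itv /= y0 ltW.
  exact: interval_closed.
rewrite /= in_itv /= => /andP[-> x1]; rewrite lt_neqAle x1 andbT.
by apply/eqP => xe; apply: xQ; exists 1 => //; rewrite rmorph1.
Qed.

End gauss_porous.

(** * Measure, category and density *)

Section size_of_gauss_dense.
Variable R : realType.
Implicit Types (x y lo hi : R) (F : set R).

Lemma null_no_itv F lo hi : lebesgue_measure F = 0 -> lo < hi ->
  measurable F -> ~ `]lo, hi[ `<=` F.
Proof.
move=> F0 lohi mF KF.
have : (lebesgue_measure (`]lo, hi[%classic : set R) <= lebesgue_measure F)%E.
  by apply: le_measure; rewrite ?inE//; exact: measurable_itv.
by rewrite F0 lebesgue_measure_itv /= lte_fin lohi -EFinB lee_fin; lra.
Qed.

(** The interval need not contain y, so the ends 0 and 1 are treated like interior points. *)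
Lemma nbhs_unit_itv y (B : set R) : unit_itv R y -> nbhs y B ->
  exists lo hi, [/\ 0 <= lo, lo < hi, hi <= 1 & `]lo, hi[ `<=` B].
Proof.
rewrite /unit_itv /= in_itv /= => /andP[y0 y1] /nbhs_ballP[e /= e0 yB].
exists (Num.max 0 (y - e)), (Num.min 1 (y + e)); split.
- by rewrite le_max lexx.
- by rewrite gt_max !lt_min; apply/andP; split; apply/andP; split; lra.
- by rewrite ge_min lexx.
move=> z; rewrite /= in_itv /= gt_max lt_min => /andP[/andP[_ z1] /andP[_ z2]].
by apply: yB; rewrite /ball /= ltr_norml; apply/andP; split; lra.
Qed.

Lemma rat_gauss_compl x : unit_itv R x -> ~ gauss_dense R x ->
  range (@ratr R) x \/
  exists a b : rat, [/\ 0 < a, a < b, b <= 1 & gauss_avoid (ratr a) (ratr b) x].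
Proof.
rewrite /unit_itv /= in_itv /= => /andP[x0 x1] xD.
have [xe|xn1] := eqVneq x 1; first by left; exists 1 => //; rewrite rmorph1.
have x01 : 0 <= x < 1 by rewrite x0 lt_neqAle xn1.
right; have : ~ (unit_itv R `<=` closure (gauss_orbit x)).
  move=> H; apply: xD; split; first by rewrite /= in_itv.
  split=> // _ [n _ <-]; rewrite /unit_itv /= in_itv /=.
  by have /andP[-> /ltW ->] := iter_gauss_itv n x01.
move=> /existsNP[y /not_implyP[y01 /existsNP[B /not_implyP[yB xB]]]].
have [lo [hi [lo0 lohi hi1 KB]]] := nbhs_unit_itv y01 yB.
(* Rational ends keep the family of avoided intervals countable; choosing a strictly above [lo]
   makes it positive. *)
have [b] := rat_in_itvoo lohi; rewrite in_itv /= => /andP[lob bhi].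
have [a] := rat_in_itvoo lob; rewrite in_itv /= => /andP[loa ab].
exists a, b; split.
- by rewrite -(@ltr_rat R) rmorph0; lra.
- by rewrite -(@ltr_rat R).
- by rewrite -(@ler_rat R) rmorph1; lra.
split=> // n; apply/negP => /andP[ax xb]; apply: xB.
exists (iter n (@gauss_map R) x); split; first by exists n.
by apply: KB; rewrite /= in_itv /=; apply/andP; split; lra.
Qed.

(** The index type [rat + rat * rat] is countable, so [unpickle] lists the family; indices that
    describe no admissible interval get the empty set. *)
Lemma gauss_compl_cover : exists G : nat -> set R,
  (forall n, lebesgue_measure (closure (G n)) = 0) /\
  gauss_dense_compl R `<=` \bigcup_n G n.
Proof.
pose G0 (i : rat + rat * rat) : set R := match i with
  | inl q => [set ratr q]
  | inr p => if (0 < p.1) && (p.1 < p.2) && (p.2 <= 1)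
             then gauss_avoid (ratr p.1) (ratr p.2) else set0
  end.
exists (fun n => if unpickle n is Some i then G0 i else set0); split.
  move=> n; case: unpickle => [[q|[a b]]|] /=; last by rewrite closure0 measure0.
    have clq : closed ([set ratr q] : set R).
      exact/accessible_closed_set1/hausdorff_accessible/Rhausdorff.
    by rewrite -((closure_id _).1 clq) lebesgue_measure_set1.
  case: ifP => [/andP[/andP[a0 ab] b1]|_]; last by rewrite closure0 measure0.
  apply: gauss_avoid_null.
  - by rewrite -(rmorph0 (@ratr R)) ltr_rat.
  - by rewrite ltr_rat.
  - by rewrite -(rmorph1 (@ratr R)) ler_rat.
move=> x [x01 xD]; have [[q _ qx]|[a [b [a0 ab b1 xab]]]] := rat_gauss_compl x01 xD.
  by exists (pickle (inl q : rat + rat * rat)); [exact: I|rewrite pickleK /G0 qx].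
exists (pickle (inr (a, b) : rat + rat * rat)); first exact: I.
by rewrite pickleK /G0 a0 ab b1.
Qed.

Lemma gauss_compl_negligible :
  (@lebesgue_measure R).-negligible (gauss_dense_compl R).
Proof.
have [G [G0 GD]] := gauss_compl_cover.
suff [N [mN N0 GN]] : (@lebesgue_measure R).-negligible (\bigcup_n G n).
  by exists N; split => //; exact: subset_trans GN.
apply: negligible_bigcup => n; exists (closure (G n)); split.
  exact: closed_measurable (@closed_closure _ _).
  exact: G0.
by move=> x Gx; apply: (@subset_closure R (G n)).
Qed.

Lemma nbhs_subspaceE (A : set R) (z : subspace A) (B : set R) : A z ->
  @nbhs _ (subspace A) z B = within A (@nbhs _ R z) B.
Proof. by move=> Az; exact: (congr1 (@^~ B) (esym (@nbhs_subspace_in R A z Az))). Qed.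

Lemma null_nowhere_dense F : F `<=` unit_itv R ->
  lebesgue_measure (closure F) = 0 -> @nowhere_dense (subspace (unit_itv R)) F.
Proof.
move=> F01 F0; apply/seteqP; split => // x /= xF.
have clF z : unit_itv R z -> @closure (subspace (unit_itv R)) F z -> closure F z.
  move=> z01 zF B zB; apply: zF; rewrite nbhs_subspaceE//.
  by apply: filterS zB => w.
have [x01|x01] := pselect (unit_itv R x).
  move: xF; rewrite /interior /= nbhs_subspaceE// => xF.
  have [lo [hi [lo0 lohi hi1 KB]]] := nbhs_unit_itv x01 xF.
  apply: (null_no_itv F0 lohi); first exact: closed_measurable (@closed_closure _ _).
  move=> z Kz; have z01 : unit_itv R z.
    by move: Kz; rewrite /unit_itv /= !in_itv /= => /andP[? ?]; apply/andP; split; lra.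
  by apply: clF => //; exact: KB.
(* A point outside [0, 1] is isolated in the subspace: its singleton is a neighbourhood that misses
   F. *)
have /(_ [set x]) := nbhs_singleton xF.
case.
  change (nbhs_subspace (x : subspace (unit_itv R)) [set x]).
  by rewrite -(@nbhs_subspace_out R _ _ x01).
by move=> z [Fz zx]; apply: x01; rewrite -zx; exact: F01.
Qed.

Lemma gauss_compl_meager : meager_in (unit_itv R) (gauss_dense_compl R).
Proof.
have [G [G0 GD]] := gauss_compl_cover.
(* Meagerness asks for an equality with the union, hence the intersection. *)
exists (fun n => gauss_dense_compl R `&` G n); split; last first.
  by rewrite -setI_bigcupr; apply/esym/setIidPl.
move=> n; apply: null_nowhere_dense; first by move=> x [[]].
apply/eqP; rewrite -measure_le0 -(G0 n); apply: le_measure; rewrite ?inE.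
- exact: closed_measurable (@closed_closure _ _).
- exact: closed_measurable (@closed_closure _ _).
- by apply: closure_subset => x [].
Qed.

Lemma gauss_dense_dense : dense_in (unit_itv R) (gauss_dense R).
Proof.
split=> [x [] |y y01 B yB].
  by rewrite /unit_itv /= !in_itv /= => /andP[-> /ltW ->].
have [lo [hi [lo0 lohi hi1 KB]]] := nbhs_unit_itv y01 yB.
apply: contrapT => /forallNP nB.
have [N [mN N0 DN]] := gauss_compl_negligible.
apply: (null_no_itv N0 lohi mN) => x Kx; apply: DN; split.
  by move: Kx; rewrite /unit_itv /= !in_itv /= => /andP[? ?]; apply/andP; split; lra.
by move=> xD; apply: (nB x); split => //; exact: KB.
Qed.

(** This is Euclid's algorithm: the map sends p/q to (q mod p)/p. *)
Lemma gauss_orbit_frac (p q : nat) : (p < q)%N ->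
  exists n, iter n (@gauss_map R) (p%:R / q%:R) = 0.
Proof.
elim/ltn_ind: p q => p IH q pq; have [->|p0] := posnP p.
  by exists 0%N; rewrite /= mul0r.
have [n nE] := IH _ (ltn_pmod q p0) _ (ltn_pmod q p0).
exists n.+1; rewrite iterSr.
have p0R : 0 < p%:R :> R by rewrite ltr0n.
have -> : p%:R / q%:R = ((q %/ p)%:R + (q %% p)%:R / p%:R)^-1 :> R.
  rewrite {1}(divn_eq q p) natrD natrM -[LHS]invrK invf_div.
  by congr (_^-1); field; rewrite gt_eqF.
rewrite gauss_map_inv ?divn_gt0// 1?ltnW// divr_ge0//= ltr_pdivrMr// mul1r.
by rewrite ltr_nat ltn_pmod.
Qed.

(** The orbit reaches 0 and stays there, so it is finite, hence closed and null, and cannot be dense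
    in [0, 1]. *)
Lemma rat_notin_gauss_dense (r : rat) : 0 < r < 1 -> ~ gauss_dense R (ratr r).
Proof.
move=> /andP[r0 r1] [_ [_ rD]].
have [n nE] : exists n, iter n (@gauss_map R) (ratr r) = 0.
  have rE : ratr r = (`|numq r|)%N%:R / (`|denq r|)%N%:R :> R.
    rewrite /ratr !natr_absz !ger0_norm ?denq_ge0// ?numq_ge0 ltW//.
  rewrite rE; apply: gauss_orbit_frac.
  rewrite -(@ltr_nat R) -subr_gt0.
  have : ratr r < 1 :> R by rewrite -(rmorph1 (@ratr R)) ltr_rat.
  by rewrite rE ltr_pdivrMr ?mul1r ?subr_gt0// ltr0n absz_gt0 denq_neq0.
have fO : finite_set (gauss_orbit (ratr r : R)).
  apply: (@sub_finite_set _ _ ((fun k => iter k (@gauss_map R) (ratr r)) @` `I_n.+1)).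
    move=> _ [k _ <-]; have [kn|nk] := ltnP k n; first by exists k => //=; exact: ltnW.
    exists n => //=; rewrite -(subnK nk) iterD nE.
    by elim: (k - n)%N => [//|m /= <-]; rewrite /gauss_map eqxx.
  exact/finite_image/finite_II.
have cO : closed (gauss_orbit (ratr r : R)).
  apply: (accessible_finite_set_closed (T := R)).1 => //.
  exact/hausdorff_accessible/Rhausdorff.
have O0 : lebesgue_measure (gauss_orbit (ratr r : R)) = 0.
  by apply: countable_lebesgue_measure0; exact: finite_set_countable.
apply: (null_no_itv O0 (@ltr01 R)); first exact: closed_measurable.
move=> x; rewrite /= in_itv /= => /andP[x0 x1].
by rewrite ((closure_id _).1 cO); apply: rD; rewrite /unit_itv /= in_itv /= !ltW.
Qed.

Lemma gauss_compl_dense : dense_in (unit_itv R) (gauss_dense_compl R).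
Proof.
split=> [x [] //|y y01 B yB].
have [lo [hi [lo0 lohi hi1 KB]]] := nbhs_unit_itv y01 yB.
have [q] := rat_in_itvoo lohi; rewrite in_itv /= => /andP[loq qhi].
exists (ratr q); split; last by apply: KB; rewrite /= in_itv /= loq.
split; first by rewrite /unit_itv /= in_itv /=; apply/andP; split; lra.
apply: rat_notin_gauss_dense; rewrite -!(@ltr_rat R) rmorph0 rmorph1.
by apply/andP; split; lra.
Qed.

End size_of_gauss_dense.

(** * Upper bound for the Hausdorff dimension *)

Section hausdorff_upper.
Variable R : realType.
Local Open Scope ereal_scope.
Implicit Types (A U : set R) (s d : R).

Lemma diameter_ge0 U : 0 <= diameter U.
Proof. by rewrite /diameter le_max lexx. Qed.

Lemma dist_le_diameter U (x y : R) : U x -> U y ->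
  (`|x - y|%R)%:E <= diameter U.
Proof.
move=> Ux Uy; rewrite /diameter le_max; apply/orP; right.
by apply: ereal_sup_ubound; exists (x, y).
Qed.

Lemma diameter_itv_le (a b : R) : (a <= b)%R ->
  diameter `[a, b]%classic <= (b - a)%:E.
Proof.
move=> ab; rewrite /diameter ge_max lee_fin subr_ge0 ab /=.
apply: ge_ereal_sup => _ [[x y] /= [+ +] <-].
rewrite /= !in_itv /= lee_fin ler_norml => /andP[? ?] /andP[? ?].
by apply/andP; split; lra.
Qed.

Lemma hausdorff_weight_ge0 s U : 0 <= hausdorff_weight s U.
Proof. by rewrite /hausdorff_weight; case: ifP => // _; exact: poweR_ge0. Qed.

Lemma hausdorff_weight_le s U (e : R) : (0 <= s)%R -> diameter U <= e%:E ->
  hausdorff_weight s U <= (e `^ s)%:E.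
Proof.
move=> s0 Ue; rewrite /hausdorff_weight; case: ifP => _.
  by rewrite lee_fin powR_ge0.
rewrite -poweR_EFin gt0_ler_poweR// in_itv /= leey andbT ?diameter_ge0//.
exact: le_trans (diameter_ge0 U) Ue.
Qed.

Lemma hausdorff_delta_ge0 s d A : 0 <= hausdorff_delta s d A.
Proof.
apply: le_ereal_inf_tmp => _ [U _ <-].
by apply: nneseries_ge0 => n _ _; exact: hausdorff_weight_ge0.
Qed.

(** Covering [0, 1] by 1/h intervals of length h costs h^(s - 1), which tends to 0 with h. *)
Lemma hausdorff_measure_unit_itv0 A s : A `<=` unit_itv R -> (1 < s)%R ->
  hausdorff_measure s A = 0.
Proof.
move=> A01 s1; apply/eqP; rewrite eq_le; apply/andP; split; last first.
  apply: (le_trans (hausdorff_delta_ge0 s 1 A)).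
  by apply: ereal_sup_ubound; exists 1%R => /=.
apply: ge_ereal_sup => _ [d /= d0 <-]; apply/lee_addgt0Pr => e e0; rewrite add0e.
(* The two thresholds ensure h <= d and h^(s - 1) <= e. *)
have m0 : (0 < Num.min d (e `^ (s - 1)^-1))%R by rewrite lt_min d0 powR_gt0.
have [n _ /(_ n (leqnn n)) /=] := near_infty_natSinv_lt (PosNum m0).
set h := (n.+1%:R^-1)%R; rewrite /= lt_min => /andP[hd he].
have h0 : (0 < h)%R by rewrite invr_gt0.
have hn : (n.+1%:R * h = 1)%R by rewrite mulfV.
pose U i : set R := if (i < n.+1)%N then `[(i%:R * h)%R, (i.+1%:R * h)%R]%classic
                    else set0.
have Uh i : diameter (U i) <= h%:E.
  rewrite /U; case: ifP => _; last first.
    rewrite /diameter setX0 image_set0 ereal_sup0 ge_max leNye andbT.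
    by rewrite lee_fin ltW.
  apply: le_trans (diameter_itv_le _) _.
    by rewrite ler_wpM2r ?ler_nat// ltW.
  by rewrite lee_fin -mulrBl -natrB// subSnn mul1r.
apply: (@le_trans _ _ (\sum_(0 <= i <oo) hausdorff_weight s (U i))).
  apply: ereal_inf_lbound; exists U => //; split; last first.
    by move=> i; apply: (le_trans (Uh i)); rewrite lee_fin ltW.
  move=> x /A01; rewrite /unit_itv /= in_itv /= => /andP[x0 x1].
  have xh0 : (0 <= x / h)%R by rewrite divr_ge0// ltW.
  (* The point 1 belongs to the last interval, whereas truncating 1/h would give an index one too
     large. *)
  have [xe|xn1] := eqVneq x 1%R.
    exists n => //; rewrite /U ltnSn /= in_itv /= hn xe lexx andbT.
    by rewrite -[X in (_ <= X)%R]hn ler_wpM2r ?ler_nat ?leqnSn ?ltW//.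
  have fx : ((Num.truncn (x / h))%:R <= x / h < (Num.truncn (x / h)).+1%:R)%R.
    by rewrite truncn_itv.
  exists (Num.truncn (x / h)) => //; rewrite /U.
  case/andP: fx => f1 f2.
  rewrite ifT; last first.
    rewrite -(@ltr_nat R) (le_lt_trans f1)// ltr_pdivrMr// hn.
    by rewrite lt_neqAle xn1.
  by rewrite /= in_itv /= -ler_pdivlMr// f1 -ler_pdivrMr// ltW.
rewrite (@nneseries_split _ _ 0%N n.+1); last first.
  by move=> i _; exact: hausdorff_weight_ge0.
rewrite add0n [X in _ + X]eseries0 ?adde0; last first.
  by move=> i ni _; rewrite /U ltnNge ni /= /hausdorff_weight eqxx.
apply: (@le_trans _ _ (\sum_(0 <= i < n.+1) (h `^ s)%:E)).
  by apply: lee_sum => i _; apply: hausdorff_weight_le => //; lra.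
rewrite sumEFin lee_fin sumr_const_nat subn0 -mulr_natl -mulr_powRB1//; [|lra|lra].
rewrite mulrA hn mul1r.
have -> : (e = (e `^ (s - 1)^-1) `^ (s - 1))%R.
  by rewrite -powRrM mulVf ?powRr1// ?ltW// subr_eq0 gt_eqF.
by apply: ge0_ler_powR; rewrite ?nnegrE ?powR_ge0// ?ltW// subr_gt0.
Qed.

Lemma hausdorff_dim_le1 A : A `<=` unit_itv R -> hausdorff_dim A <= 1.
Proof.
move=> A01; apply/lee_addgt0Pr => e e0; apply: ereal_inf_lbound.
exists (1 + e)%R => //=; split; first lra.
by apply: hausdorff_measure_unit_itv0 => //; lra.
Qed.

End hausdorff_upper.

(** * The Cantor set of points with digits at most N *)

Section bounded_digits.
Variable R : realType.
Variable N : nat.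
Hypothesis N0 : (0 < N)%N.
Implicit Types (v : seq nat) (t u x y s : R).

(* The tails 1/(a1 + 1/(a2 + ...)) with all digits at most N lie in
   [lo_tail, hi_tail]. *)
Definition lo_tail : R := N.+1%:R^-1.
Definition hi_tail : R := (1 + lo_tail)^-1.
Local Notation al := lo_tail.
Local Notation be := hi_tail.

(** The two equations are the definitions of the bounds cleared of inverses, in the form that
    arithmetic tactics can use. *)
Lemma tail_bounds : [/\ 0 < al, al <= be, be < 1, be + al * be = 1 &
  al * N%:R + al = 1].
Proof.
have NR : (1 : R) <= N%:R by rewrite ler1n.
have a0 : 0 < al by rewrite invr_gt0.
have aN : al * N%:R + al = 1.
  by rewrite -[X in _ + X]mulr1 -mulrDr natr1 mulVf.
have bE : be + al * be = 1.
  by rewrite -[X in X + _]mul1r -mulrDl mulfV// gt_eqF// addr_gt0.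
have b0 : 0 < be by rewrite invr_gt0 addr_gt0.
split=> //; last nra.
have a12 : al <= 2^-1 by nra.
nra.
Qed.

Definition bdigits v := all (fun a => 0 < a <= N)%N v.

Lemma bdigitsW v : bdigits v -> digits v.
Proof. by apply: sub_all => a /andP[]. Qed.

Definition bcyl v : set R := cf v @` `[al, be].

Lemma inv_digit_tail a t : (0 < a <= N)%N -> al <= t <= be ->
  al <= (a%:R + t)^-1 <= be.
Proof.
move=> /andP[a0 aN] /andP[t1 t2]; have [al0 _ be1 beE alE] := tail_bounds.
have a1R : (1 : R) <= a%:R by rewrite ler1n.
have aNR : a%:R <= N%:R :> R by rewrite ler_nat.
apply/andP; split.
  rewrite /al lef_pV2 ?posrE ?ltr0n//; last lra.
  by rewrite -natr1; lra.
by rewrite /be lef_pV2 ?posrE//; lra.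
Qed.

Lemma bcyl_sub a v : (0 < a <= N)%N -> bcyl (a :: v) `<=` bcyl v.
Proof.
move=> aN x [t]; rewrite /= in_itv /= => tab <-.
by exists ((a%:R + t)^-1) => //; rewrite /= in_itv /=; exact: inv_digit_tail.
Qed.

(** The factor 1/2 comes from [cf_lip], [al ^+ 2] from the two inverses (a + t)^-1 and (b + u)^-1,
    and the last [al] from the distance of a + t and b + u, which is at least 1 - (be - al). *)
Definition gap : R := al ^+ 3 / 2.

Lemma gap_gt0 : 0 < gap.
Proof. by rewrite divr_gt0// exprn_gt0//; case: tail_bounds. Qed.

Lemma bcyl_gap v a b x y : bdigits v -> (0 < a <= N)%N -> (0 < b <= N)%N ->
  a != b -> bcyl (a :: v) x -> bcyl (b :: v) y ->
  gap * cflen R v <= `|x - y|.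
Proof.
move=> /bdigitsW pv aN bN ab [t + <-] [u + <-]; rewrite /= !in_itv /= => tab uab.
have [al0 _ be1 beE alE] := tail_bounds.
have /andP[ta1 ta2] := inv_digit_tail aN tab.
have /andP[ub1 ub2] := inv_digit_tail bN uab.
case/andP: tab => t1 t2; case/andP: uab => u1 u2.
have [a1 a2] : (1 : R) <= a%:R /\ a%:R <= N%:R :> R.
  by move: aN; rewrite ler1n ler_nat => /andP.
have [b1 b2] : (1 : R) <= b%:R /\ b%:R <= N%:R :> R.
  by move: bN; rewrite ler1n ler_nat => /andP.
have /andP[+ _] := @cf_lip R v (a%:R + t)^-1 (b%:R + u)^-1 pv
  ltac:(by lra) ltac:(by lra).
apply: le_trans; have -> : gap * cflen R v = cflen R v / 2 * al ^+ 3.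
  by rewrite /gap; ring.
apply: ler_wpM2l; first by rewrite divr_ge0// ltW// cflen_gt0.
have -> : (a%:R + t)^-1 - (b%:R + u)^-1 =
    (b%:R - a%:R + (u - t)) * ((a%:R + t)^-1 * (b%:R + u)^-1) by field; lra.
rewrite normrM exprS.
apply: ler_pM; [exact: ltW|by rewrite exprn_ge0// ltW| |]; last first.
  by rewrite expr2 ger0_norm; [apply: ler_pM; lra|apply: mulr_ge0; lra].
have al1 : al <= 1 - (be - al).
  by nra.
move: ab; rewrite neq_ltn => /orP[] ab; rewrite -(ler_nat R) -natr1 in ab.
  by rewrite ger0_norm; lra.
by rewrite ler0_norm; lra.
Qed.

Lemma bcyl_compact v : bdigits v -> compact (bcyl v).
Proof.
move=> pv; apply: continuous_compact; last exact: segment_compact.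
by apply: within_continuous_cf; [exact: bdigitsW|case: tail_bounds].
Qed.

(** The sum telescopes: each term is (1 + y) times the difference of the inverses of i + 1 + y and i
    + 2 + y. *)
Lemma digit_ratio_sum y : 0 <= y ->
  \sum_(i < N) (1 + y) / ((i.+1%:R + y) * (i.+1%:R + 1 + y)) =
  1 - (1 + y) / (N.+1%:R + y).
Proof.
move=> y0; elim: N => [|n IH]; first by rewrite big_ord0 divff ?subrr// gt_eqF//; lra.
have n0 : (0 : R) <= n%:R by [].
rewrite big_ord_recr /= IH -!natr1; field.
by rewrite !gt_eqF//=; lra.
Qed.

(** A ratio r <= 1/2 satisfies r^s >= K r with K = 2^(1 - s). The ratios sum to N/(N + 1 + y) with y
    <= 1, so the hypothesis on N yields at least 1. *)
Lemma cflen_powR_sum v s : 0 < s < 1 ->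
  N%:R + 2 <= (2^-1 `^ (1 - s))^-1 * N%:R -> bdigits v ->
  cflen R v `^ s <= \sum_(i < N) cflen R (i.+1 :: v) `^ s.
Proof.
move=> /andP[s0 s1] NK /bdigitsW pv.
have NR : (1 : R) <= N%:R by rewrite ler1n.
have [q0 q'0 qq'] := cfden_bounds R pv.
have y0 : 0 <= (cfden R v).2 / (cfden R v).1 by rewrite divr_ge0// ltW.
have y1 : (cfden R v).2 / (cfden R v).1 <= 1 by rewrite ler_pdivrMr// mul1r.
have lenE (i : 'I_N) := @cflen_cons R v i.+1 pv isT.
move: (_ / _) y0 y1 lenE => y y0 y1 /= lenE.
set K := (X in _ <= X * _) in NK.
have K0 : 0 < K by rewrite invr_gt0 powR_gt0.
have ratio (i : 'I_N) : K * ((1 + y) / ((i.+1%:R + y) * (i.+1%:R + 1 + y))) <=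
    ((1 + y) / ((i.+1%:R + y) * (i.+1%:R + 1 + y))) `^ s.
  have i0 : (0 : R) < i.+1%:R by [].
  have := @digit_ratio_le R i.+1 y isT y0; move: (_ / _) => /= r.
  have [r0|r0] := leP r 0; first by move=> _; rewrite (le_trans _ (powR_ge0 _ _))//; nra.
  move=> r2; rewrite -(mulr_powRB1 (ltW r0) s0) mulrC; apply: ler_wpM2l; first exact: ltW.
  rewrite -opprB powRN /K lef_pV2 ?posrE ?powR_gt0//.
  by apply: ge0_ler_powR; rewrite ?nnegrE//; lra.
have -> : \sum_(i < N) cflen R (i.+1 :: v) `^ s = cflen R v `^ s *
    \sum_(i < N) ((1 + y) / ((i.+1%:R + y) * (i.+1%:R + 1 + y))) `^ s.
  rewrite big_distrr; apply: eq_bigr => i _; rewrite lenE powRM//.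
    by rewrite ltW// cflen_gt0.
  have i0 : (0 : R) < i.+1%:R by [].
  by rewrite divr_ge0 ?mulr_ge0//; lra.
rewrite -[X in X <= _]mulr1 ler_wpM2l ?powR_ge0//.
apply: (@le_trans _ _ (\sum_(i < N) K *
    ((1 + y) / ((i.+1%:R + y) * (i.+1%:R + 1 + y))))); last exact: ler_sum.
rewrite -big_distrr /= digit_ratio_sum// -natr1.
have D0 : 0 < N%:R + 1 + y by lra.
have -> : 1 - (1 + y) / (N%:R + 1 + y) = N%:R / (N%:R + 1 + y) by field; lra.
by rewrite mulrA ler_pdivlMr// mul1r; lra.
Qed.

(** All iterates stay above [al], so the orbit misses a ball around 0. *)
Lemma bcyl_branch_compl (V : nat -> seq nat) x :
  (forall n, bdigits (V n) /\ size (V n) = n) -> (forall n, bcyl (V n) x) ->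
  gauss_dense_compl R x.
Proof.
move=> VP Vx; have [al0 _ be1 _ _] := tail_bounds.
have orb n : al <= iter n (@gauss_map R) x <= be.
  have [/bdigitsW pv <-] := VP n; have [t + <-] := Vx n.
  rewrite /= in_itv /= => /andP[t1 t2].
  by rewrite iter_gauss_cf// ?t1//; apply/andP; split; lra.
have /= /andP[x0 x1] := orb 0%N.
split; first by rewrite /unit_itv /= in_itv /=; apply/andP; split; lra.
move=> [_ [_ /(_ 0)]].
have z01 : unit_itv R 0 by rewrite /unit_itv /= in_itv /= lexx ler01.
move=> /(_ z01 (ball 0 al) (nbhsx_ballx _ _ al0)) [_ [[n _ <-]]].
rewrite /ball /= sub0r normrN => H; have /andP[? _] := orb n.
by move: H; rewrite ger0_norm; lra.
Qed.

Lemma bcyl_branch_point (V : nat -> seq nat) :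
  (forall n, bdigits (V n)) -> (forall n, bcyl (V n.+1) `<=` bcyl (V n)) ->
  exists x, forall n, bcyl (V n) x.
Proof.
move=> VP Vsub; have [al0 albe _ _ _] := tail_bounds.
have VD m n : (m <= n)%N -> bcyl (V n) `<=` bcyl (V m).
  elim: n => [|n IH]; first by rewrite leqn0 => /eqP ->.
  by rewrite leq_eqVlt => /predU1P[->//|/IH H]; exact: subset_trans (Vsub n) H.
pose X n := cf (V n) al.
have XV n : bcyl (V n) (X n) by exists al => //; rewrite /= in_itv /= lexx.
have XF m : (X @ \oo) (bcyl (V m)).
  by exists m => // n /= mn; apply: (VD _ _ mn); exact: XV.
(* A cluster point of the points [X n] lies in every cylinder, since each is closed and contains
   almost all of them. *)
have [x [_ xcl]] := bcyl_compact (VP 0%N) _ (XF 0%N).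
exists x => n; have cln := compact_closed (@Rhausdorff R) (bcyl_compact (VP n)).
by apply: cln => B xB; exact: xcl.
Qed.

(** * Lower bound for the total weight of a cover *)

Section mass_distribution.
Variables (s : R) (U : nat -> set R) (w : nat -> R).
Hypotheses (s01 : 0 < s < 1) (NK : N%:R + 2 <= (2^-1 `^ (1 - s))^-1 * N%:R).
Hypotheses (w0 : forall i, 0 < w i)
  (Uw : forall i x y, U i x -> U i y -> `|x - y| `^ s <= w i).

Definition hit_weight v i : \bar R :=
  if `[< U i `&` bcyl v !=set0 >] then (w i)%:E else 0%E.

Definition cover_mass v : \bar R := (\sum_(0 <= i <oo) hit_weight v i)%E.

Lemma hit_weight_ge0 v i : (0 <= hit_weight v i)%E.
Proof. by rewrite /hit_weight; case: ifP => // _; rewrite lee_fin ltW. Qed.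

Lemma hit_weight_le_mass v i : (hit_weight v i <= cover_mass v)%E.
Proof.
apply: (@le_trans _ _ (\sum_(0 <= j < i.+1) hit_weight v j)%E); last first.
  by apply: nneseries_lim_ge => n _ _; exact: hit_weight_ge0.
rewrite big_nat_recr//= leeDr//.
by apply: sume_ge0 => j _; exact: hit_weight_ge0.
Qed.

(* A covering set meeting two children of [v] is as long as the gap between
   them, so it alone would have too much mass. *)
Lemma hit_weight_children v i : bdigits v ->
  (cover_mass v < ((gap * cflen R v) `^ s)%:E)%E ->
  (\sum_(a < N) hit_weight (a.+1 :: v) i <= hit_weight v i)%E.
Proof.
move=> pv mv; have [s0 s1] := andP s01.
have digitN (a : 'I_N) : (0 < a.+1 <= N)%N by rewrite ltn_ord.
have [[a [x [Ux ax]]]|noa] :=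
  pselect (exists a : 'I_N, U i `&` bcyl (a.+1 :: v) !=set0); last first.
  rewrite big1 ?hit_weight_ge0// => a _; rewrite /hit_weight ifF//.
  by apply/negP => /asboolP ha; apply: noa; exists a.
have hv : hit_weight v i = (w i)%:E.
  rewrite /hit_weight ifT//; apply/asboolP; exists x; split => //.
  exact: bcyl_sub ax.
rewrite (bigD1 a)//= [X in (_ + X)%E]big1 ?adde0 => [|b ba].
  rewrite hv {1}/hit_weight; case: ifP => // _.
  by rewrite lee_fin ltW.
rewrite /hit_weight ifF//; apply/negP => /asboolP[y [Uy by_]].
have := le_lt_trans (hit_weight_le_mass v i) mv; rewrite hv lte_fin ltNge.
move=> /negP; apply; apply: le_trans (Uw Uy Ux).
apply: ge0_ler_powR; rewrite ?nnegrE//; first exact: ltW.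
  by rewrite ltW// mulr_gt0 ?gap_gt0 ?cflen_gt0//; exact: bdigitsW.
by apply: (bcyl_gap pv _ _ _ by_ ax) => //; rewrite eqSS.
Qed.

(** If all children were heavy, their masses would add up to at least the bound for v by
    [cflen_powR_sum], but to at most the mass of v by [hit_weight_children]. *)
Lemma light_child v : bdigits v ->
  (cover_mass v < ((gap * cflen R v) `^ s)%:E)%E ->
  exists a, (0 < a <= N)%N /\
    (cover_mass (a :: v) < ((gap * cflen R (a :: v)) `^ s)%:E)%E.
Proof.
move=> pv mv; apply: contrapT => /forallNP noa.
move: (mv); apply/negP; rewrite -leNgt.
have heavy (a : 'I_N) :
    (((gap * cflen R (a.+1 :: v)) `^ s)%:E <= cover_mass (a.+1 :: v))%E.
  by rewrite leNgt; apply/negP => h; apply: (noa a.+1); rewrite ltn_ord.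
apply: (@le_trans _ _ (\sum_(a < N) cover_mass (a.+1 :: v))%E).
  apply: (@le_trans _ _ (\sum_(a < N) ((gap * cflen R (a.+1 :: v)) `^ s)%:E)%E).
    rewrite sumEFin lee_fin.
    have g0 := ltW gap_gt0.
    rewrite powRM//; last by rewrite ltW// cflen_gt0// bdigitsW.
    under eq_bigr => a _.
      rewrite powRM//; last first.
        by rewrite ltW// cflen_gt0//= bdigitsW.
      over.
    by rewrite -big_distrr /= ler_wpM2l ?powR_ge0// cflen_powR_sum.
  by apply: lee_sum => a _; exact: heavy.
rewrite /cover_mass -nneseries_sum; last by move=> a j _; exact: hit_weight_ge0.
apply: lee_nneseries => i _.
  by move=> _; apply: sume_ge0 => a _; exact: hit_weight_ge0.
exact: hit_weight_children.
Qed.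

Lemma cover_mass_lb : gauss_dense_compl R `<=` \bigcup_i U i ->
  ((gap `^ s)%:E <= cover_mass [::])%E.
Proof.
move=> cov; rewrite leNgt; apply/negP => m0; have [s0 s1] := andP s01.
pose light v := bdigits v /\
  (cover_mass v < ((gap * cflen R v) `^ s)%:E)%E.
have /choice[f fP] : forall v, exists a, light v ->
    (0 < a <= N)%N /\ light (a :: v).
  (* Words that are not light receive the dummy digit 0; the branch [V] runs through light words
     only. *)
  move=> v; have [[pv mv]|nl] := pselect (light v); last by exists 0%N.
  have [a [aN ma]] := light_child pv mv; exists a => _; split => //.
  by split => //=; rewrite aN.
pose V n := iter n (fun v => f v :: v) [::].
have VL n : light (V n).
  elim: n => [|n IH]; last by have [] := fP _ IH.
  by split => //; rewrite /cflen /= addr0 mulr1 invr1 mulr1.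
have Vsz n : size (V n) = n by elim: n => [//|n /= ->].
have [x xV] : exists x, forall n, bcyl (V n) x.
  apply: bcyl_branch_point => n; first by case: (VL n).
  by apply: bcyl_sub; case: (fP _ (VL n)).
have [i _ Ux] : (\bigcup_i U i) x.
  by apply: cov; apply: (bcyl_branch_compl _ xV) => n; split => //; case: (VL n).
(* The set [U i] contains x, so it is counted in the mass of every cylinder of the branch, and these
   masses tend to 0. *)
have wlt n : w i < (gap * 2^-1 ^+ n) `^ s.
  have [pv mv] := VL n; have := le_lt_trans (hit_weight_le_mass (V n) i) mv.
  rewrite /hit_weight ifT; last by apply/asboolP; exists x.
  rewrite lte_fin => /lt_le_trans; apply; apply: ge0_ler_powR.
  - exact: ltW.
  - by rewrite nnegrE mulr_ge0 ?ltW ?gap_gt0 ?cflen_gt0 ?bdigitsW.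
  - by rewrite nnegrE mulr_ge0 ?ltW ?gap_gt0// exprn_gt0.
  - apply: ler_wpM2l; first exact/ltW/gap_gt0.
    by have := cflen_exp R (bdigitsW pv); rewrite Vsz.
have [n ne] : exists n, gap * 2^-1 ^+ n <= w i `^ s^-1.
  have wg : 0 < w i `^ s^-1 / gap by rewrite divr_gt0 ?powR_gt0 ?gap_gt0.
  have /cvgr0_norm_lt/(_ _ wg) :=
    @cvg_expr R 2^-1 ltac:(by rewrite ger0_norm; lra).
  move=> [n _ /(_ n (leqnn n))] /=; rewrite ger0_norm ?exprn_ge0// => h.
  by exists n; rewrite mulrC -ler_pdivlMr ?gap_gt0// ltW.
have := wlt n; apply/negP; rewrite -leNgt.
have -> : w i = (w i `^ s^-1) `^ s.
  by rewrite -powRrM mulVf ?gt_eqF// powRr1// ltW.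
apply: ge0_ler_powR => //; first exact: ltW.
  by rewrite nnegrE mulr_ge0 ?ltW ?gap_gt0// exprn_gt0.
by rewrite nnegrE powR_ge0.
Qed.

End mass_distribution.

End bounded_digits.

(** * Lower bound for the Hausdorff dimension *)

Section hausdorff_lower.
Variable R : realType.

(** With K = 2^(1 - s) > 1 the condition reads N >= 2/(K - 1). *)
Lemma exists_digit_bound (s : R) : s < 1 -> exists N : nat,
  (0 < N)%N /\ N%:R + 2 <= (2^-1 `^ (1 - s))^-1 * N%:R.
Proof.
move=> s1; set K := (2^-1 `^ (1 - s))^-1.
have K1 : 1 < K.
  have E : (1 : R) `^ (1 - s) = 1 by rewrite powR1.
  rewrite /K invf_gt1 ?powR_gt0// -[X in _ < X]E.
  by apply: gt0_ltr_powR; rewrite ?nnegrE//; lra.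
have K10 : 0 < K - 1 by lra.
exists (Num.truncn (2 / (K - 1))).+1; split => //.
have : 2 / (K - 1) < (Num.truncn (2 / (K - 1))).+1%:R.
  by rewrite truncnS_gt.
by rewrite ltr_pdivrMr//; nra.
Qed.

Lemma gauss_compl_hausdorff_neq0 (s : R) : 0 <= s < 1 ->
  hausdorff_measure s (gauss_dense_compl R) <> 0%E.
Proof.
move=> /andP[s0 s1] H0.
(* Passing to s' makes the exponent positive even for s = 0; on diameters at most 1 the power s' is
   bounded by the power s. *)
pose s' := (s + 1) / 2; have s'01 : 0 < s' < 1 by rewrite /s'; lra.
have ss' : s <= s' by rewrite /s'; lra.
have [N [N0 NK]] := exists_digit_bound (proj2 (andP s'01)).
(* One half of [gap] to the power s' bounds the sum of the cover; the other half pays for making the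
   weights positive. *)
pose e := gap R N `^ s' / 2; have e0 : 0 < e.
  by rewrite divr_gt0// powR_gt0// gap_gt0.
have : (hausdorff_delta s 1 (gauss_dense_compl R) < e%:E)%E.
  apply: (@le_lt_trans _ _ 0%E); last by rewrite lte_fin.
  by rewrite -H0; apply: ereal_sup_ubound; exists 1 => /=.
move=> /ereal_inf_lt[_ [U [cov Ud] <-] Ue].
have wfin i : hausdorff_weight s (U i) \is a fin_num.
  rewrite ge0_fin_numE ?hausdorff_weight_ge0//.
  by rewrite (le_lt_trans (hausdorff_weight_le s0 (Ud i)))// ltry.
(* The added terms sum to e and make each weight positive, even that of an empty set or a single
   point. *)
pose w i : R := fine (hausdorff_weight s (U i)) + e / (2 ^ i.+1)%:R.
have w0 i : 0 < w i.
  apply: ltr_wpDl; first by rewrite fine_ge0// hausdorff_weight_ge0.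
  by rewrite divr_gt0// ltr0n expn_gt0.
have Uw i x y : U i x -> U i y -> `|x - y| `^ s' <= w i.
  move=> Ux Uy; apply: (@le_trans _ _ (fine (hausdorff_weight s (U i)))); last first.
    by rewrite lerDl divr_ge0// ltW.
  rewrite -lee_fin fineK// /hausdorff_weight ifF; last first.
    by apply/negP => /eqP Ui; rewrite Ui in Ux.
  have [->|xy] := eqVneq `|x - y| 0.
    by rewrite powR0 ?poweR_ge0// gt_eqF//; case/andP: s'01.
  have d1 : `|x - y| <= 1.
    by rewrite -lee_fin; exact: le_trans (dist_le_diameter Ux Uy) (Ud i).
  apply: (@le_trans _ _ (`|x - y| `^ s)%:E).
    by rewrite lee_fin ger_powR// d1 lt_neqAle eq_sym xy normr_ge0.
  rewrite -poweR_EFin gt0_ler_poweR// ?dist_le_diameter//.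
    by rewrite in_itv /= leey lee_fin normr_ge0.
  by rewrite in_itv /= leey diameter_ge0.
have := @cover_mass_lb R N N0 s' U w s'01 NK w0 Uw cov.
apply/negP; rewrite -ltNge.
apply: (@le_lt_trans _ _ (\sum_(0 <= i <oo) hausdorff_weight s (U i) + e%:E)%E).
  apply: le_trans (epsilon_trick _ _ _); last exact: ltW.
    apply: lee_nneseries => i _; first by move=> _; exact: hit_weight_ge0.
    rewrite /hit_weight; case: ifP => _; first by rewrite EFinD fineK.
    by rewrite adde_ge0 ?hausdorff_weight_ge0// lee_fin divr_ge0// ltW.
  by move=> n; exact: hausdorff_weight_ge0.
have -> : gap R N `^ s' = e + e by rewrite /e -splitr.
by rewrite EFinD lteD2rE.
Qed.

Lemma hausdorff_dim_gauss_compl : hausdorff_dim (gauss_dense_compl R) = 1%:E.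
Proof.
apply/eqP; rewrite eq_le hausdorff_dim_le1/=; last by move=> x [].
apply: le_ereal_inf_tmp => _ [s [/= s0 H0] <-]; rewrite lee_fin leNgt.
by apply/negP => s1; apply: (@gauss_compl_hausdorff_neq0 s _ H0); rewrite s0.
Qed.

End hausdorff_lower.

Unset Implicit Arguments.

Theorem theorem1p1 (R : realType) :
  [/\ (@lebesgue_measure R).-negligible (gauss_dense_compl R),
      hausdorff_dim (gauss_dense_compl R) = 1%:E,
      meager_in (unit_itv R) (gauss_dense_compl R) &
      dense_in (unit_itv R) (gauss_dense_compl R) /\
      dense_in (unit_itv R) (gauss_dense R)].
Proof.
split.
- exact: gauss_compl_negligible.
- exact: hausdorff_dim_gauss_compl.
- exact: gauss_compl_meager.
- by split; [exact: gauss_compl_dense|exact: gauss_dense_dense].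
Qed.
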